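(* Let $X$ be a metric space which is quasi-isometric to a QPC metric space. Then $$\operatorname{rank}_h X\le\operatorname{corank} X.$$ In particular, there is no quasi-isometric embedding $Y\to X$ of a locally compact $\operatorname{CAT}(-1)$ Hadamard space $Y$ with $\dim\partial_\infty Y>\operatorname{corank} X$; and if $X$ itself is QPC, then $X$ supports no subexponential partition of rank less than $\operatorname{rank}_h X$.
   Context: **Quasi-isometries.** A (not necessarily continuous) map $f:X\to Y$ between metric spaces is quasi-isometric (a quasi-isometric embedding) if there are $a\ge1$, $b\ge0$ with $\frac1a\operatorname{dist}(x,x')-b\le\operatorname{dist}(f(x),f(x'))\le a\operatorname{dist}(x,x')+b$ for all $x,x'\in X$. It is a quasi-isometry if in addition $f(X)$ is a net in $Y$, where a subset $A\subset Y$ is a net if $\sup_{y\in Y}\operatorname{dist}(y,A)<\infty$. Then $X,Y$ are called quasi-isometric. **QPC.** A metric space $X$ is QPC if for every metric space $Y$ and every quasi-isometric map $f:Y\to X$ there is a continuous map $f':Y\to X$ with $\sup_{y\in Y}\operatorname{dist}(f'(y),f(y))<\infty$. **Dimension.** For a compact space $K$, $\dim K$ is the minimal integer $n$ such that every open covering of $K$ has a refinement which is a finite closed covering of multiplicity $\le n+1$. For a topological space $X$, $\dim X=\sup\{\dim K: K\subset X \text{ compact}\}$. **Hyperbolic rank.** $\operatorname{rank}_h X=\sup_Y\dim\partial_\infty Y$, the supremum being over all locally compact $\operatorname{CAT}(-1)$ Hadamard spaces $Y$ (complete $\operatorname{CAT}(-1)$ spaces) admitting a quasi-isometric map $Y\to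 X$; $\partial_\infty Y$ is the boundary at infinity with its standard (cone) topology. **Size.** $B_r(x)$ and $\overline B_r(x)$ denote open and closed balls. A subset $A\subset X$ is $\delta$-separated ($\delta>0$) if $\operatorname{dist}(a,a')\ge\delta$ for all distinct $a,a'\in A$. Given a maximal $\delta$-separated net $X_\delta\subset X$ and $\sigma\ge\delta$, the size of $A\subset X$ is the number $\operatorname{size}_{X_\delta,\sigma}(A)\in\mathbb N\cup\{\infty\}$ of points $x\in X_\delta$ with $B_\sigma(x)\cap A\ne\emptyset$. **Subexponential partitions.** A continuous partition $(X,g,T)$ of a metric space $X$ is given by a continuous map $g:X\to T$ to a topological space $T$ (the partition being $X=\bigcup_{t\in T}g^{-1}(t)$). Its rank is $\operatorname{rank}(X,g,T)=\sup\{\dim g(K):K\subset X\text{ compact}\}$. Fix $x_0\in X$. The partition is subexponential if for each maximal $\delta$-separated net $X_\delta\subset X$ with sufficiently large $\delta$, each sufficiently large $\sigma\ge\delta$ and every $\varepsilon>0$ there is $R_0=R_0(X_\delta,\sigma,\varepsilon)\ge1$ such that for every $R\ge R_0$ and every $t\in T$ $$\tfrac1R\ln\operatorname{size}_{X_\delta,\sigma}\bigl(g^{-1}(t)\cap\overline B_R(x_0)\bigr)<\varepsilon.$$ This is independent of the choice of $x_0$. One says $X$ supports a subexponential partition of rank $k$ if there is a subexponential $(X,g,T)$ with $\operatorname{rank}(X,g,T)=k$. **Subexponential corank.** $\operatorname{corank} X=\sup_{Z}\inf\operatorname{rank}(Z,g,T)$, where the supremum is over all metric spaces $Z$ quasi-isometric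 to $X$ and the infimum is over all subexponential partitions $(Z,g,T)$ of $Z$.
   Formalization: The target T of a continuous partition is required to be Hausdorff; for arbitrary T the claim fails, e.g. the identity map of H^3 to itself with the indiscrete topology is a subexponential partition of rank 0, while the hyperbolic rank of H^3 is at least 2. *)

(* Defs.v *)
From HB Require Import structures.
From mathcomp Require Import all_boot all_order all_algebra.
From mathcomp Require Import all_classical all_reals all_analysis.

Set Implicit Arguments.
Unset Strict Implicit.
Unset Printing Implicit Defensive.

Import Order.TTheory GRing.Theory Num.Theory.

Local Open Scope classical_set_scope.
Local Open Scope ring_scope.

Section QuasiIsometry.
Context {R : realType}.
Implicit Types X Y : metricType R.

Definition quasi_isometric_map X Y (f : X -> Y) : Prop :=
  exists a b : R, [/\ 1 <= a, 0 <= b &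
    forall x x' : X,
      a^-1 * mdist x x' - b <= mdist (f x) (f x') <= a * mdist x x' + b].

Definition dist_to X (A : set X) (x : X) : \bar R :=
  ereal_inf [set (mdist x a)%:E | a in A].

Definition is_net X (A : set X) : Prop :=
  (ereal_sup [set dist_to A x | x in [set: X]] < +oo)%E.

Definition quasi_isometry X Y (f : X -> Y) : Prop :=
  quasi_isometric_map f /\ is_net (range f).

Definition quasi_isometric X Y : Prop := exists f : X -> Y, quasi_isometry f.

Definition QPC X : Prop :=
  forall (Y : metricType R) (f : Y -> X), quasi_isometric_map f ->
    exists f' : Y -> X, continuous f' /\
      (ereal_sup [set (mdist (f' y) (f y))%:E | y in [set: Y]] < +oo)%E.

End QuasiIsometry.

Section Dimension.
Context {T : topologicalType}.
Implicit Type K : set T.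

Definition multiplicity_le (k : nat) (F : 'I_k -> set T) (m : nat) : Prop :=
  forall x : T, (#|[set i : 'I_k | `[< F i x >]]%SET| <= m)%N.

(* With m = n + 1, this is the condition on n in the definition of dim K.
   Open and closed sets of the subspace K are traces of those of T. *)
Definition has_closed_refinements K (m : nat) : Prop :=
  forall U : set (set T), U `<=` open -> K `<=` \bigcup_(u in U) u ->
  exists (k : nat) (F : 'I_k -> set T),
    [/\ closed_fam_of K setT F,
        \bigcup_i F i = K,
        forall i, exists2 u, U u & F i `<=` u
      & multiplicity_le F m].

End Dimension.

(* Dimensions live in \bar R: the empty space has dimension -1, and the
   dimension is +oo when no n satisfies the condition. *)
Definition compact_dim (R : realType) (T : topologicalType) (K : set T)
    : \bar R :=
  ereal_inf [set (m%:R - 1)%:E | m in [set m | has_closed_refinements K m]].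

Definition top_dim (R : realType) (T : topologicalType) : \bar R :=
  ereal_sup [set compact_dim R K | K in [set K : set T | compact K]].

Section HyperbolicPlane.
Context {R : realType}.

(* the upper half-plane model, with points given by their two coordinates *)
Definition hplane : set (R * R) := [set z | 0 < z.2].

Definition arcosh (x : R) : R := ln (x + Num.sqrt (x ^+ 2 - 1)).

Definition hdist (z w : R * R) : R :=
  arcosh (1 + ((z.1 - w.1) ^+ 2 + (z.2 - w.2) ^+ 2) / (2 * z.2 * w.2)).

End HyperbolicPlane.

Section Hadamard.
Context {R : realType}.
Implicit Type Y : metricType R.

Definition geodesic Y (p q : Y) (c : R -> Y) : Prop :=
  [/\ c 0 = p, c (mdist p q) = q &
    forall s t, 0 <= s <= mdist p q -> 0 <= t <= mdist p q ->
      mdist (c s) (c t) = `|s - t|].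

Definition geodesic_space Y : Prop :=
  forall p q : Y, exists c : R -> Y, geodesic p q c.

(* x' is the point of the segment [p', q'] of the hyperbolic plane at
   distance s from p' *)
Definition comparison_point (p' q' : R * R) (s : R) (x' : R * R) : Prop :=
  [/\ hplane x', hdist p' x' = s & hdist x' q' = hdist p' q' - s].

(* Only two sides issuing from a common vertex p occur: any two distinct sides
   are of this form after relabelling the vertices, and for two points of one
   side the inequality is an equality. The comparison triangle is unique up to
   isometry, hence the universal quantifier over p', q', r'. *)
Definition CATm1 Y : Prop :=
  geodesic_space Y /\
  forall (p q r : Y) (c1 c2 : R -> Y), geodesic p q c1 -> geodesic p r c2 ->
  forall p' q' r' : R * R, hplane p' -> hplane q' -> hplane r' ->
    hdist p' q' = mdist p q -> hdist p' r' = mdist p r ->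
    hdist q' r' = mdist q r ->
  forall (s t : R) (x' y' : R * R),
    0 <= s <= mdist p q -> 0 <= t <= mdist p r ->
    comparison_point p' q' s x' -> comparison_point p' r' t y' ->
    mdist (c1 s) (c2 t) <= hdist x' y'.

Definition complete_space Y : Prop :=
  forall F : set_system Y, ProperFilter F -> cauchy F -> exists y : Y, F --> y.

Definition CATm1_Hadamard Y : Prop := CATm1 Y /\ complete_space Y.

End Hadamard.

Section Boundary.
Context {R : realType} (Y : metricType R).

(* the values of a ray at negative times are irrelevant *)
Record ray := Ray {
  ray_fun :> R -> Y;
  ray_isometric : forall s t, 0 <= s -> 0 <= t ->
    mdist (ray_fun s) (ray_fun t) = `|s - t| }.

Definition asymptotic (c c' : ray) : Prop :=
  exists C : R, forall t, 0 <= t -> mdist (c t) (c' t) <= C.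

(* the quotient of the set of rays by the relation asymptotic *)
Record boundary := Boundary {
  bclass : set ray;
  bclassP : exists c : ray, bclass = asymptotic c }.

HB.instance Definition _ := gen_eqMixin boundary.
HB.instance Definition _ := gen_choiceMixin boundary.

(* classes having a representative issuing from c 0 and within e of c at
   time r *)
Definition cone_nbhs (c : ray) (r e : R) : set boundary :=
  [set xi | exists c' : ray,
    [/\ bclass xi c', c' 0 = c 0 & mdist (c' r) (c r) < e]].

(* The cone topology based at o is generated by the sets cone_nbhs c r e with
   c 0 = o; since it does not depend on o, the sets with arbitrary c generate
   the same topology. *)
Definition cone_subbase : set_system boundary :=
  [set U | exists (c : ray) (r e : R),
    [/\ 0 <= r, 0 < e & U = cone_nbhs c r e]].

HB.instance Definition _ :=
  isSubBaseTopological.Build boundary cone_subbase id.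

End Boundary.

Section HyperbolicRank.
Context {R : realType}.

Definition rank_h (X : metricType R) : \bar R :=
  ereal_sup [set d | exists Y : metricType R,
    [/\ locally_compact [set: Y], CATm1_Hadamard Y,
        exists f : Y -> X, quasi_isometric_map f
      & d = top_dim R (boundary Y)]].

End HyperbolicRank.

Section Partitions.
Context {R : realType}.
Implicit Type X : metricType R.

Definition delta_separated X (delta : R) (A : set X) : Prop :=
  forall a a', A a -> A a' -> a <> a' -> delta <= mdist a a'.

Definition maximal_separated_net X (delta : R) (A : set X) : Prop :=
  delta_separated delta A /\
  forall B : set X, delta_separated delta B -> A `<=` B -> B = A.

Definition cball X (x : X) (r : R) : set X := [set y | mdist x y <= r].

Definition net_size X (N : set X) (sigma : R) (A : set X) : \bar R :=
  counting [set x | N x /\ ball x sigma `&` A !=set0].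

Definition subexponential_at X (x0 : X) (T : topologicalType) (g : X -> T)
    : Prop :=
  exists2 delta0 : R, 0 < delta0 &
  forall (delta : R) (N : set X),
    delta0 <= delta -> maximal_separated_net delta N ->
  exists sigma0 : R, forall sigma : R, sigma0 <= sigma -> delta <= sigma ->
  forall eps : R, 0 < eps ->
  exists2 R0 : R, 1 <= R0 & forall r : R, R0 <= r -> forall t : T,
    (r^-1%:E * lne (net_size N sigma (g @^-1` [set t] `&` cball x0 r))
      < eps%:E)%E.

(* The choice of x0 is immaterial. *)
Definition subexponential X (T : topologicalType) (g : X -> T) : Prop :=
  forall x0 : X, subexponential_at x0 g.

Definition partition_rank X (T : topologicalType) (g : X -> T) : \bar R :=
  ereal_sup [set compact_dim R (g @` K) | K in [set K : set X | compact K]].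

(* T is required to be Hausdorff, the usual convention of dimension theory, so
   that the spaces g(K) are compact Hausdorff. For an indiscrete T every map g
   is continuous and of rank at most 0, even an injective one. *)
Definition supports_subexp_partition X (k : \bar R) : Prop :=
  exists (T : topologicalType) (g : X -> T),
    [/\ hausdorff_space T, continuous g, subexponential g
      & partition_rank g = k].

Definition corank X : \bar R :=
  ereal_sup [set d | exists2 Z : metricType R, quasi_isometric Z X &
    d = ereal_inf [set k | supports_subexp_partition Z k]].

End Partitions.

(* Main.v *)
Require Import Defs.
From mathcomp Require Import all_boot all_order all_algebra.
From mathcomp Require Import all_classical all_reals all_analysis.
From mathcomp Require Import ring lra finmap.

(** Let [f : Y -> X] be a quasi-isometric map into a QPC space, which we may
    take continuous, let [g : X -> T] be a subexponential partition, and let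
    [K] be a compact subset of the boundary of [Y]. Following the rays issuing
    from a base point up to a large time [r] and then applying [g \o f] gives a
    continuous map [phi] from [K] to [T]. By subexponentiality a fibre of [phi]
    is covered by at most [exp (r / 2)] sets that have bounded diameter at time
    [r]; by CAT(-1) comparison these sets have diameter of order [exp (- r)] at
    any fixed earlier time. A chain of such sets is therefore still small, so
    the fibre splits into finitely many small relatively open pieces. A closed
    refinement downstairs of multiplicity at most [m] then lifts to a closed
    refinement of [K] with the same bound, because the pieces over one set
    downstairs are disjoint. *)

Import Order.TTheory GRing.Theory Num.Theory.
Import numFieldNormedType.Exports.

Set Implicit Arguments.
Unset Strict Implicit.
Unset Printing Implicit Defensive.

Local Open Scope classical_set_scope.
Local Open Scope ring_scope.

(** * Hyperbolic functions and the law of cosines in the upper half-plane *)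

Section hyperbolic.
Context {R : realType}.
Implicit Types a b c s t u v w x y z : R.

Definition cosh x : R := (expR x + expR (- x)) / 2.
Definition sinh x : R := (expR x - expR (- x)) / 2.

Lemma cosh_sqr x : cosh x ^+ 2 = 1 + sinh x ^+ 2.
Proof.
have e1 := expRxMexpNx_1 x.
suff -> : cosh x ^+ 2 = sinh x ^+ 2 + expR x * expR (- x) by rewrite e1 addrC.
by rewrite /cosh /sinh; field.
Qed.

Lemma coshB a b : cosh (a - b) = cosh a * cosh b - sinh a * sinh b.
Proof.
by rewrite /cosh /sinh opprB !expRD; field.
Qed.

Lemma coshD a b : cosh (a + b) = cosh a * cosh b + sinh a * sinh b.
Proof. by rewrite /cosh /sinh opprD !expRD; field. Qed.

Lemma sinh_ge0 x : 0 <= x -> 0 <= sinh x.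
Proof.
by move=> x0; rewrite divr_ge0// subr_ge0 ler_expR; lra.
Qed.

Lemma sinh_gt0 x : 0 < x -> 0 < sinh x.
Proof.
by move=> x0; rewrite divr_gt0// subr_gt0 ltr_expR; lra.
Qed.

Lemma cosh_gt0 x : 0 < cosh x.
Proof. by rewrite divr_gt0// addr_gt0// expR_gt0. Qed.

Lemma coshN x : cosh (- x) = cosh x.
Proof. by rewrite /cosh opprK addrC. Qed.

Lemma cosh_norm x : cosh `|x| = cosh x.
Proof. by case: (ger0P x) => // _; rewrite coshN. Qed.

Lemma cosh_ge1 x : 1 <= cosh x.
Proof.
rewrite -(@ler_pXn2r _ 2%N)// ?nnegrE ?(ltW (cosh_gt0 _))//.
by rewrite expr1n cosh_sqr lerDl sqr_ge0.
Qed.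

Lemma coshK x : 0 <= x -> arcosh (cosh x) = x.
Proof.
move=> x0; rewrite /arcosh cosh_sqr addrAC subrr add0r sqrtr_sqr.
rewrite ger0_norm ?sinh_ge0// -[RHS]expRK; congr ln.
by rewrite /cosh /sinh; field.
Qed.

Lemma ler_arcosh x y : 1 <= x -> x <= y -> arcosh x <= arcosh y.
Proof.
move=> x1 xy; have p z : 1 <= z -> 0 < z + Num.sqrt (z ^+ 2 - 1).
  by move=> z1; rewrite ltr_wpDr// ?sqrtr_ge0// (lt_le_trans ltr01).
rewrite ler_ln ?posrE ?p//; last exact: le_trans xy.
by rewrite lerD// ler_wsqrtr// lerD2r lerXn2r// nnegrE; lra.
Qed.

Lemma ler_cosh x y : 0 <= x -> x <= y -> cosh x <= cosh y.
Proof.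
move=> x0 xy; rewrite -(subrK x y) coshD -[leLHS]mul1r.
rewrite -[leLHS]addr0 lerD//; last by rewrite mulr_ge0// sinh_ge0//; lra.
by rewrite ler_pM2r ?cosh_gt0// cosh_ge1.
Qed.

(* The point at distance [s] from [(0, 1)] in the direction of the unit vector
   [(u, v)], carried over from the hyperboloid point
   [(cosh s, sinh s * u, sinh s * v)]. *)
Definition hpoint s u v : R * R :=
  (sinh s * v / (cosh s - sinh s * u), (cosh s - sinh s * u)^-1).

Lemma hpoint_gt0 s u v : u ^+ 2 + v ^+ 2 = 1 -> 0 < cosh s - sinh s * u.
Proof.
move=> uv; have c0 := cosh_gt0 s; have cE := cosh_sqr s.
rewrite subr_gt0 ltNge; apply/negP => h.
have h2 : cosh s ^+ 2 <= (sinh s * u) ^+ 2 by rewrite lerXn2r// nnegrE; lra.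
by move: h2; rewrite exprMn; nra.
Qed.

Lemma hplane_hpoint s u v : u ^+ 2 + v ^+ 2 = 1 -> hplane (hpoint s u v).
Proof. by move=> uv; rewrite /hplane/= invr_gt0 (hpoint_gt0 _ uv). Qed.

(** The law of cosines at [(0, 1)]: [u * u' + v * v'] is the cosine of the angle between the two
    directions. In the inverse heights [q] and [q'] it is an identity of rational functions, since
    [(sinh s * v) ^+ 2 + 1] factors as [q * (cosh s + sinh s * u)]. *)
Lemma hdist_hpoint s t u v u' v' : u ^+ 2 + v ^+ 2 = 1 -> u' ^+ 2 + v' ^+ 2 = 1 ->
  hdist (hpoint s u v) (hpoint t u' v') =
  arcosh (cosh s * cosh t - sinh s * sinh t * (u * u' + v * v')).
Proof.
move=> uv uv'; have q0 := hpoint_gt0 s uv; have q0' := hpoint_gt0 t uv'.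
congr arcosh; rewrite /=; have cs := cosh_sqr s; have ct := cosh_sqr t.
set q := cosh s - _ in q0 *; set q' := cosh t - _ in q0' *.
have e : (sinh s * v / q - sinh t * v' / q') ^+ 2 + (q^-1 - q'^-1) ^+ 2 =
  (((sinh s * v) ^+ 2 + 1) * q' ^+ 2 + ((sinh t * v') ^+ 2 + 1) * q ^+ 2
   - 2 * (sinh s * v * (sinh t * v') + 1) * q * q') / (q * q') ^+ 2.
  by field; rewrite ?gt_eqF.
have -> : 1 + ((sinh s * v / q - sinh t * v' / q') ^+ 2 + (q^-1 - q'^-1) ^+ 2) /
    (2 * q^-1 * q'^-1) = 1 + (((sinh s * v) ^+ 2 + 1) * q' ^+ 2 +
    ((sinh t * v') ^+ 2 + 1) * q ^+ 2
   - 2 * (sinh s * v * (sinh t * v') + 1) * q * q') / (2 * q * q').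
  by rewrite e; field; rewrite ?gt_eqF.
have -> : (sinh s * v) ^+ 2 + 1 = q * (cosh s + sinh s * u).
  rewrite /q -subr_sqr cs !exprMn -[X in _ = X - _]addrC.
  by rewrite (_ : v ^+ 2 = 1 - u ^+ 2); [ring|rewrite -uv; ring].
have -> : (sinh t * v') ^+ 2 + 1 = q' * (cosh t + sinh t * u').
  rewrite /q' -subr_sqr ct !exprMn.
  by rewrite (_ : v' ^+ 2 = 1 - u' ^+ 2); [ring|rewrite -uv'; ring].
have -> : cosh s + sinh s * u = 2 * cosh s - q by rewrite /q; ring.
have -> : cosh t + sinh t * u' = 2 * cosh t - q' by rewrite /q'; ring.
have -> : sinh s * sinh t * (u * u' + v * v') =
    (cosh s - q) * (cosh t - q') + sinh s * v * (sinh t * v').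
  by rewrite /q /q'; ring.
by field; rewrite ?gt_eqF.
Qed.

(** By [cosh x = 1 + 2 * sinh (x / 2) ^+ 2] and the crude bound [x / 4 <= sinh (x / 2)]. *)
Lemma cosh_ge_quadratic x : 0 <= x -> 1 + x ^+ 2 / 8 <= cosh x.
Proof.
move=> x0; have h : x / 4 <= sinh (x / 2).
  have e0 := expR_gt0 (x / 2); have e1 := expR_ge1Dx (x / 2).
  rewrite /sinh expRN; set e := expR _ in e0 e1 *.
  have : e^-1 <= 1 by rewrite invf_le1//; lra.
  by lra.
have -> : x = x / 2 + x / 2 by lra.
rewrite coshD -expr2 cosh_sqr -splitr.
have : (x / 4) ^+ 2 <= sinh (x / 2) ^+ 2 by rewrite lerXn2r// nnegrE; lra.
by move: h x0; set y := sinh _; rewrite -expr2; nra.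
Qed.

Lemma sinh_le_expR x : 0 <= x -> sinh x <= expR x / 2.
Proof. by move=> x0; rewrite ler_pM2r// lerBlDr lerDl expR_ge0. Qed.

Lemma sinh_ge_expR x : 1 <= x -> expR x / 4 <= sinh x.
Proof.
move=> x1; have e1 : 2 <= expR x by have := expR_ge1Dx x; lra.
rewrite /sinh expRN; have : (expR x)^-1 <= 2^-1.
  by rewrite lef_pV2// posrE; lra.
by lra.
Qed.

(* By the law of cosines, the quotient is the cosine of the angle between the
   sides [a] and [b] of a triangle with third side [c]. *)
Lemma comparison_angle a b c : 0 < a -> 0 < b -> `|a - b| <= c <= a + b ->
  -1 <= (cosh a * cosh b - cosh c) / (sinh a * sinh b) <= 1.
Proof.
move=> a0 b0 /andP[abc cab].
have sa := sinh_gt0 a0; have sb := sinh_gt0 b0.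
have sab : 0 < sinh a * sinh b by rewrite mulr_gt0.
have c0 : 0 <= c by apply: le_trans abc.
rewrite ler_pdivrMr// ler_pdivlMr// mulN1r mul1r.
have := ler_cosh (normr_ge0 _) abc; rewrite cosh_norm coshB.
by have := ler_cosh c0 cab; rewrite coshD; lra.
Qed.

End hyperbolic.

(** * Thin triangles in CAT(-1) spaces *)

Section thin_triangles.
Context {R : realType} {Y : metricType R}.

(* The exponent is [t] minus the Gromov product of [p] and [q] at [o]. *)
Lemma CATm1_thin (o p q : Y) (c1 c2 : R -> Y) (t : R) : CATm1 Y ->
  geodesic o p c1 -> geodesic o q c2 -> 1 <= mdist o p -> 1 <= mdist o q ->
  0 <= t -> t <= mdist o p -> t <= mdist o q ->
  mdist (c1 t) (c2 t) <= 6 * expR (t + (mdist p q - mdist o p - mdist o q) / 2).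
Proof.
move=> [_ cat] g1 g2; set a := mdist o p; set b := mdist o q.
set c := mdist p q => a1 b1 t0 ta tb.
have a0 : 0 < a by lra.
have b0 : 0 < b by lra.
have c0 : 0 <= c by exact: mdist_ge0.
have abc : `|a - b| <= c <= a + b.
  have := metric_triangle p o q; have := metric_triangle o p q.
  have := metric_triangle o q p; rewrite -/a -/b -/c (metric_sym p o).
  rewrite (metric_sym q p) -/a -/c => h1 h2 h3.
  by apply/andP; split => //; rewrite ler_norml; apply/andP; split; lra.
(* [u] is the cosine of the comparison angle at [o]: the comparison triangle has vertices
   [hpoint 0 1 0], [hpoint a 1 0] and [hpoint b u v]. *)
have := comparison_angle a0 b0 abc; move uE : (_ / _) => u u1.
have [v uv] : exists v, u ^+ 2 + v ^+ 2 = 1.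
  have u21 : 0 <= 1 - u ^+ 2.
    have -> : 1 - u ^+ 2 = (1 - u) * (1 + u) by ring.
    by move: u1 => /andP[? ?]; rewrite mulr_ge0//; lra.
  by exists (Num.sqrt (1 - u ^+ 2)); rewrite (sqr_sqrtr u21) addrC subrK.
have v10 : (1 : R) ^+ 2 + 0 ^+ 2 = 1 by rewrite expr1n expr0n addr0.
have d0 s (u' v' : R) : 0 <= s -> u' ^+ 2 + v' ^+ 2 = 1 ->
    hdist (hpoint 0 1 0) (hpoint s u' v') = s.
  move=> s0 uv'; rewrite hdist_hpoint// /sinh oppr0 subrr !mul0r subr0.
  by rewrite {1}/cosh oppr0 expR0 divff// mul1r coshK.
have dr s s' (u' v' : R) : s <= s' -> u' ^+ 2 + v' ^+ 2 = 1 ->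
    hdist (hpoint s u' v') (hpoint s' u' v') = s' - s.
  move=> s0 uv'; rewrite hdist_hpoint// -!expr2 uv' mulr1 -coshB -coshN opprB.
  by rewrite coshK// subr_ge0.
have sab : 0 < sinh a * sinh b by rewrite mulr_gt0// sinh_gt0.
have cosu : cosh a * cosh b - sinh a * sinh b * u = cosh c.
  by rewrite -uE; field; rewrite ?gt_eqF// sinh_gt0.
have tt : 0 <= t <= a by rewrite t0.
have tt' : 0 <= t <= b by rewrite t0.
have := cat o p q c1 c2 g1 g2 (hpoint 0 1 0) (hpoint a 1 0) (hpoint b u v)
  (hplane_hpoint _ v10) (hplane_hpoint _ v10) (hplane_hpoint _ uv)
  (d0 _ _ _ (ltW a0) v10) (d0 _ _ _ (ltW b0) uv) _ t t
  (hpoint t 1 0) (hpoint t u v) tt tt'.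
rewrite hdist_hpoint// mul1r mul0r addr0 cosu coshK// => /(_ erefl).
have cp s (u' v' : R) : t <= s -> u' ^+ 2 + v' ^+ 2 = 1 ->
    comparison_point (hpoint 0 1 0) (hpoint s u' v') t (hpoint t u' v').
  move=> ts uv'; split; [exact: hplane_hpoint|exact: d0|].
  by rewrite dr// d0//; lra.
move=> /(_ (cp _ _ _ ta v10) (cp _ _ _ tb uv)) h; apply: le_trans h _.
rewrite hdist_hpoint// mul1r mul0r addr0.
(* It suffices to bound [cosh] of the comparison distance by [1 + z ^+ 2 / 8]. With
   [Q = expR (2 * t + c - a - b)], the excess over 1 is at most [4 * Q], while
   [z ^+ 2 / 8 = 36 / 8 * Q]; hence the constant 6. *)
set z := 6 * _; have z0 : 0 <= z by rewrite mulr_ge0// expR_ge0.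
rewrite -[leRHS]coshK//.
have tE : cosh t * cosh t - sinh t * sinh t * u = 1 + sinh t ^+ 2 * (1 - u).
  by rewrite -!expr2 cosh_sqr; ring.
have u10 : 0 <= 1 - u by move: u1 => /andP[]; lra.
apply: ler_arcosh; rewrite tE; first by rewrite lerDl mulr_ge0// sqr_ge0.
apply: le_trans (cosh_ge_quadratic z0); rewrite lerD2l.
have st : sinh t ^+ 2 <= (expR t / 2) ^+ 2.
  by rewrite lerXn2r ?nnegrE ?sinh_ge0// ?sinh_le_expR// divr_ge0// expR_ge0.
(* Each [sinh] in the denominator is at least a quarter of the exponential because [a] and [b] are
   at least 1. *)
have uab : 1 - u <= 16 * expR c / (expR a * expR b).
  have -> : 1 - u = (cosh c - cosh (a - b)) / (sinh a * sinh b).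
    by rewrite coshB -uE; field; rewrite ?gt_eqF// sinh_gt0.
  have h1 : cosh c - cosh (a - b) <= expR c.
    have := cosh_gt0 (a - b).
    have : cosh c <= expR c.
      rewrite /cosh ler_pdivrMr// mulr_natr mulr2n lerD2l ler_expR; lra.
    by lra.
  have h2 : expR a / 4 * (expR b / 4) <= sinh a * sinh b.
    by rewrite ler_pM ?sinh_ge_expR// divr_ge0// expR_ge0.
  have h3 : 0 < expR a / 4 * (expR b / 4) by rewrite mulr_gt0// divr_gt0// expR_gt0.
  have -> : 16 * expR c / (expR a * expR b) = expR c / (expR a / 4 * (expR b / 4)).
    by field; rewrite !expR_eq0.
  apply: (@le_trans _ _ (expR c / (sinh a * sinh b))).
    by rewrite ler_pM2r// invr_gt0.
  by rewrite ler_pM2l ?expR_gt0// lef_pV2.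
apply: (@le_trans _ _ ((expR t / 2) ^+ 2 * (16 * expR c / (expR a * expR b)))).
  by rewrite ler_pM// sqr_ge0.
have -> : z ^+ 2 = 36 * (expR t ^+ 2 * (expR c / (expR a * expR b))).
  rewrite /z exprMn expRD [X in _ * X]exprMn -(expRM_natl 2 (_ / 2)).
  have -> : 2%:R * ((c - a - b) / 2) = c - a - b by field.
  by rewrite !expRB; field; rewrite !expR_eq0.
have : 0 <= expR t ^+ 2 * (expR c / (expR a * expR b)).
  by rewrite mulr_ge0// ?sqr_ge0// divr_ge0// ?mulr_ge0// expR_ge0.
rewrite (_ : (_ / 2) ^+ 2 * _ = 4 * (expR t ^+ 2 * (expR c / (expR a * expR b)))).
  by lra.
by field; rewrite !expR_eq0.
Qed.

End thin_triangles.

(** * Asymptotic rays *)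

Section rays.
Context {R : realType} {Y : metricType R}.
Implicit Types (c g : ray Y) (o p q : Y) (r s t : R).

Lemma expR_small (C e : R) : 0 < e ->
  exists N : R, forall x, N <= x -> 6 * expR (C - x) < e.
Proof.
move=> e0; exists (C + 6 / e) => x Nx.
rewrite -opprB expRN ltr_pdivrMr ?expR_gt0// -ltr_pdivrMl//.
by apply: lt_le_trans (expR_ge1Dx _); rewrite mulrC; lra.
Qed.

Lemma mdist_ray c r : 0 <= r -> mdist (c 0) (c r) = r.
Proof. by move=> r0; rewrite ray_isometric// sub0r normrN ger0_norm. Qed.

Lemma ray_geodesic c r : 0 <= r -> geodesic (c 0) (c r) c.
Proof.
move=> r0; split=> //; rewrite mdist_ray// => s t /andP[s0 _] /andP[t0 _].
exact: ray_isometric.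
Qed.

Lemma asymptotic_sym c g : asymptotic c g -> asymptotic g c.
Proof. by move=> [C h]; exists C => t t0; rewrite metric_sym h. Qed.

Lemma asymptotic_trans c g c' : asymptotic c g -> asymptotic g c' -> asymptotic c c'.
Proof.
move=> [C h] [D k]; exists (C + D) => t t0.
by apply: le_trans (metric_triangle _ (g t) _) _; rewrite lerD ?h ?k.
Qed.

Lemma mdist_le_eps_eq (x y : Y) : (forall e, 0 < e -> mdist x y <= e) -> x = y.
Proof.
move=> h; apply: mdist_positivity; apply/eqP; rewrite eq_le mdist_ge0 andbT.
by apply/ler_addgt0Pl => e e0; rewrite addr0 h.
Qed.

Lemma ray_thin c g s t : CATm1 Y -> c 0 = g 0 -> 1 <= s -> 0 <= t <= s ->
  mdist (c t) (g t) <= 6 * expR (t + mdist (c s) (g s) / 2 - s).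
Proof.
move=> cat cg s1 /andP[t0 ts]; have s0 : 0 <= s by lra.
have gg := ray_geodesic g s0; rewrite -cg in gg.
have gs := mdist_ray g s0; rewrite -cg in gs.
have := CATm1_thin cat (ray_geodesic c s0) gg (t := t).
rewrite gs mdist_ray// => /(_ s1 s1 t0 ts ts) h; apply: le_trans h _.
by rewrite ler_wpM2l// ler_expR; lra.
Qed.

(** Let [s] tend to infinity in [ray_thin]: the distance at time [s] stays bounded, so the
    right-hand side tends to 0. *)
Lemma asymptotic_eq c g : CATm1 Y -> asymptotic c g -> c 0 = g 0 ->
  forall t, 0 <= t -> c t = g t.
Proof.
move=> cat [C hC] cg t t0; apply: mdist_le_eps_eq => e e0.
have [N hN] := expR_small (t + C / 2) e0.
pose s := Num.max N (Num.max 1 t).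
have sN : N <= s by rewrite le_max lexx.
have s1 : 1 <= s by rewrite !le_max lexx orbT.
have st : t <= s by rewrite !le_max lexx !orbT.
have t0s : 0 <= t <= s by rewrite t0.
apply: le_trans (ray_thin cat cg s1 t0s) _.
apply: le_trans (ltW (hN s sN)); rewrite ler_wpM2l// ler_expR.
have /hC : 0 <= s by lra.
by lra.
Qed.

(** * Moving a ray to another base point *)

Section base_change.
Variables (c : ray Y) (p : Y).
Hypothesis YH : CATm1_Hadamard Y.
Let A := mdist p (c 0).

Let le_mdist (n : R) : 0 <= n -> n - A <= mdist p (c n).
Proof.
move=> n0; have := metric_triangle (c 0) p (c n).
by rewrite mdist_ray// (metric_sym (c 0)) -/A; lra.
Qed.

(** The Gromov product of [c n] and [c m] at [p] is at least [n - A]. *)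
Let geodesics_thin n m r (sn sm : R -> Y) :
  geodesic p (c n) sn -> geodesic p (c m) sm -> n <= m ->
  1 + A <= n -> 0 <= r -> r + A <= n ->
  mdist (sn r) (sm r) <= 6 * expR (r + A - n).
Proof.
move=> gn gm nm An r0 rn; have A0 : 0 <= A by exact: mdist_ge0.
have n0 : 0 <= n by lra.
have m0 : 0 <= m by lra.
have dn := le_mdist n0; have dm := le_mdist m0.
have h : mdist (sn r) (sm r) <=
    6 * expR (r + (mdist (c n) (c m) - mdist p (c n) - mdist p (c m)) / 2).
  by apply: (CATm1_thin YH.1 gn gm) => //; lra.
apply: le_trans h _.
rewrite ler_wpM2l// ler_expR ray_isometric// ler0_norm; lra.
Qed.

(** By [geodesics_thin] the points at time [r] form a Cauchy sequence along integer [n], and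
    completeness gives the limit. *)
Let geodesics_limit r : 0 <= r -> exists y : Y, forall n (s : R -> Y),
  geodesic p (c n) s -> 1 + A <= n -> r + A <= n ->
  mdist (s r) y <= 6 * expR (r + A - n).
Proof.
move=> r0.
have /choice[s hs] : forall k : nat, exists s : R -> Y, geodesic p (c k%:R) s.
  by move=> k; exact: YH.1.1.
have Fc : cauchy (s k r @[k --> \oo]).
  apply: cauchy_exP => e e0; have [N hN] := expR_small (r + A) e0.
  pose M := Num.max N (Num.max (1 + A) (r + A)).
  have [n Mn] : exists n : nat, M <= n%:R.
    by eexists; exact: ltW (truncnS_gt _).
  move: Mn; rewrite !ge_max => /and3P[Nn An rn].
  exists (s n r); exists n => //= k /= nk.
  rewrite ballEmdist /=; apply: le_lt_trans (hN _ Nn).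
  by apply: (geodesics_thin (hs n) (hs k)) => //; rewrite ler_nat.
have [y yl] := YH.2 _ _ Fc; exists y => n s' gs' An rn.
apply/ler_addgt0Pl => e e0.
have /yl [N _ hN] : nbhs y (ball y e) by exact: nbhsx_ballx.
pose k := maxn N (Num.truncn n).+1.
have nk : n <= k%:R.
  by apply: le_trans (ltW (truncnS_gt n)) _; rewrite ler_nat leq_maxr.
have := hN k (leq_maxl _ _); rewrite /= ballEmdist /= metric_sym => hk.
rewrite addrC; apply: le_trans (metric_triangle _ (s k r) _) _.
by rewrite lerD ?(ltW hk)// (geodesics_thin gs' (hs k)).
Qed.

(** The ray is the limit of geodesics from [p] to [c n]. The explicit rate serves to compare cone
    neighbourhoods with different base points. *)
Lemma ray_from : exists g : ray Y, [/\ g 0 = p, asymptotic c g &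
  forall n r (s : R -> Y), geodesic p (c n) s ->
    1 + A <= n -> 0 <= r -> r + A <= n ->
    mdist (s r) (g r) <= 6 * expR (r + A - n)].
Proof.
(* Negative times get the dummy value [p]. *)
have /choice[g hg] : forall r, exists y : Y, 0 <= r -> forall n (s : R -> Y),
    geodesic p (c n) s -> 1 + A <= n -> r + A <= n ->
    mdist (s r) y <= 6 * expR (r + A - n).
  move=> r; have [r0|r0] := boolP (0 <= r); last by exists p.
  by have [y hy] := geodesics_limit r0; exists y.
have A0 : 0 <= A by exact: mdist_ge0.
(* A single geodesic approximates [g] at both times, so distances along [g] are limits of distances
   along geodesics. *)
have approx t t' e : 0 <= t -> 0 <= t' -> 0 < e -> exists n (s : R -> Y),
    [/\ geodesic p (c n) s, t <= mdist p (c n), t' <= mdist p (c n),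
     mdist (s t) (g t) <= e & mdist (s t') (g t') <= e].
  move=> t0 t0' e0; have [N hN] := expR_small (t + t' + A) e0.
  pose n := Num.max N (1 + A + t + t').
  have nN : N <= n by rewrite le_max lexx.
  have An : 1 + A + t + t' <= n by rewrite le_max lexx orbT.
  have [s gs] := YH.1.1 p (c n).
  have h : 6 * expR (t + t' + A - n) <= e by exact: ltW (hN _ nN).
  have n0 : 0 <= n by lra.
  have dn := le_mdist n0.
  exists n, s; split => //; try lra.
  - apply: le_trans h; apply: le_trans (hg t t0 n s gs _ _) _; try lra.
    by rewrite ler_wpM2l// ler_expR; lra.
  - apply: le_trans h; apply: le_trans (hg t' t0' n s gs _ _) _; try lra.
    by rewrite ler_wpM2l// ler_expR; lra.
have giso t t' : 0 <= t -> 0 <= t' -> mdist (g t) (g t') = `|t - t'|.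
  move=> t0 t0'; apply/eqP; rewrite -subr_eq0 -normr_le0.
  apply/ler_addgt0Pl => e e0; rewrite addr0.
  have e20 : 0 < e / 2 by lra.
  have [n [s [gs tn tn' h h']]] := approx _ _ _ t0 t0' e20.
  have [_ _ /(_ t t')] := gs; rewrite t0 t0' => /(_ tn tn') <-.
  rewrite ler_norml; apply/andP; split.
    have := metric_triangle (s t) (g t) (s t').
    have := metric_triangle (g t) (g t') (s t').
    by rewrite (metric_sym (g t')); lra.
  have := metric_triangle (g t) (s t) (g t').
  have := metric_triangle (s t) (s t') (g t').
  by rewrite (metric_sym (g t) (s t)); lra.
pose G := Ray giso; have G0 : G 0 = p.
  apply: mdist_le_eps_eq => e e0.
  have [n [s [[s0 _ _] _ _ + _]]] := approx _ _ _ (lexx 0) (lexx 0) e0.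
  by rewrite s0 metric_sym.
exists G; split => //; last by move=> n r s gs An r0 rn; exact: hg.
(* For [1 + A <= t], the steps from [c t] through [s (t - A)] and [g (t - A)] to [g t] are at most
   [2 * A], 6 and [A]. For smaller [t], going through [c 0] and [p] gives at most [3 * A + 2]. *)
exists (3 * A + 6) => t t0.
have [tA|tA] := leP (1 + A) t.
  have [s gs] := YH.1.1 p (c t).
  have tA0 : 0 <= t - A by lra.
  have h := hg _ tA0 _ _ gs tA; rewrite subrK subrr expR0 mulr1 in h.
  have {}h := h (lexx _).
  have d1 : mdist (s (t - A)) (c t) <= 2 * A.
    have [s0 s1 si] := gs.
    have dt := le_mdist t0.
    rewrite -[in leLHS]s1 si.
    - have := metric_triangle p (c 0) (c t); rewrite mdist_ray// -/A => dt'.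
      by rewrite ler_norml; apply/andP; split; lra.
    - by apply/andP; split; lra.
    - by rewrite mdist_ge0 lexx.
  have d2 : mdist (g (t - A)) (g t) = A.
    by rewrite giso// addrC addKr normrN ger0_norm.
  have := metric_triangle (c t) (s (t - A)) (g t).
  have := metric_triangle (s (t - A)) (g (t - A)) (g t).
  by rewrite (metric_sym (c t) (s _)) /=; lra.
have := metric_triangle (c t) (c 0) (G t).
have := metric_triangle (c 0) (G 0) (G t).
by rewrite (metric_sym (c t) (c 0)) !mdist_ray// G0 (metric_sym (c 0) p) -/A; lra.
Qed.

End base_change.
End rays.

(** * The boundary at infinity seen from one base point *)

Section boundary.
Context {R : realType} {Y : metricType R}.
Implicit Types (c g : ray Y) (xi : boundary Y).

Lemma bclass_asymptotic xi c g : bclass xi c -> bclass xi g -> asymptotic c g.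
Proof.
have [c0 ->] := bclassP xi => h k.
exact: asymptotic_trans (asymptotic_sym h) k.
Qed.

Lemma asymptotic_bclass xi c g : bclass xi c -> asymptotic c g -> bclass xi g.
Proof. by have [c0 ->] := bclassP xi; exact: asymptotic_trans. Qed.

Lemma bclass_ray_from xi (o : Y) : CATm1_Hadamard Y ->
  exists c, bclass xi c /\ c 0 = o.
Proof.
move=> YH; have [c cE] := bclassP xi.
have [g [g0 cg _]] := ray_from c o YH; exists g; split => //.
by rewrite cE.
Qed.

Hypothesis YH : CATm1_Hadamard Y.
Variables (o : Y) (rho : boundary Y -> ray Y).
Hypothesis rho_class : forall xi, bclass xi (rho xi).
Hypothesis rho0 : forall xi, rho xi 0 = o.

Lemma rho_thin xi xi' (s t : R) : 1 <= s -> 0 <= t <= s ->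
  mdist (rho xi t) (rho xi' t) <=
  6 * expR (t + mdist (rho xi s) (rho xi' s) / 2 - s).
Proof. by move=> s1 ts; apply: ray_thin; rewrite ?rho0//; exact: YH.1. Qed.

(** The set contains [cone_nbhs (rho xi) t e], because asymptotic rays with a common origin agree at
    nonnegative times. *)
Lemma rho_nbhs xi (t e : R) : 0 <= t -> 0 < e ->
  nbhs xi [set xi' | mdist (rho xi' t) (rho xi t) < e].
Proof.
move=> t0 e0.
have : open (cone_nbhs (rho xi) t e).
  exists [set cone_nbhs (rho xi) t e]; last by rewrite bigcup_set1.
  move=> _ ->; apply: finI_from1.
  by exists (rho xi), t, e.
set B := cone_nbhs _ _ _ => oB.
have Bxi : B xi by exists (rho xi); rewrite mdistxx.
have : nbhs xi B by apply: open_nbhs_nbhs; split.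
apply: (@filterS _ (nbhs xi)) => xi' [c' [h1 h2 h3]] /=.
rewrite -(asymptotic_eq YH.1 (bclass_asymptotic h1 (rho_class _)) _ t0)//.
by rewrite h2 !rho0.
Qed.

Lemma rho_continuous (t : R) : 0 <= t -> continuous (fun xi => rho xi t).
Proof.
move=> t0 xi A /nbhs_ballP[e e0 eA].
suff : nbhs xi [set xi' | A (rho xi' t)] by [].
apply: (@filterS _ (nbhs xi) _ _ _ _ (rho_nbhs xi t0 e0)) => xi' /= h.
by apply: eA; rewrite ballEmdist /= metric_sym.
Qed.

(** The exponent in [rho_thin] is below [1 / 2 - 13 = - (25 / 2)], and
    [expR (25 / 2) >= 27 / 2 > 12]. *)
Let small_step xi xi' (n m : R) : 0 <= n -> n + 13 <= m ->
  mdist (rho xi m) (rho xi' m) < 1 -> mdist (rho xi n) (rho xi' n) < 1 / 2.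
Proof.
move=> n0 nm h.
have m1 : 1 <= m by lra.
have nm' : 0 <= n <= m by rewrite n0; lra.
apply: le_lt_trans (rho_thin xi xi' m1 nm') _.
have e0 : 0 < expR (25 / 2 : R) by exact: expR_gt0.
apply: (@le_lt_trans _ _ (6 * expR (- (25 / 2)))).
  by rewrite ler_wpM2l// ler_expR; lra.
rewrite expRN ltr_pdivrMr//.
by have := expR_ge1Dx (25 / 2 : R); lra.
Qed.

(** The ray [c] issues from an arbitrary point [p]. The rays from [p] in the classes [xi] and [xi']
    are near the geodesics from [p] to [rho xi n%:R] and [rho xi' n%:R], which are near each other
    at time [r] because their endpoints are within 1. *)
Let cone_nbhs_basis xi c (r e : R) : 0 <= r -> cone_nbhs c r e xi ->
  \forall n \near \oo,
    [set xi' | mdist (rho xi n%:R) (rho xi' n%:R) < 1] `<=` cone_nbhs c r e.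
Proof.
move=> r0 [c' [xic' c'0 c'r]]; set d := mdist _ _ in c'r.
(* The slack [e - d] is shared among the distances from [g' r] to [s' r], from [s' r] to [s r] and
   from [s r] to [g r]. *)
have ed : 0 < (e - d) / 3 by lra.
pose p := c 0; pose A := mdist p o; have A0 : 0 <= A by exact: mdist_ge0.
have [N hN] := expR_small (r + A + 1 / 2) ed.
near=> n => xi' /=; set x := rho xi _; set y := rho xi' _ => xy.
have nN : N <= n%:R by near: n; exact: nbhs_infty_ger.
have nA : 1 + A + r <= n%:R by near: n; exact: nbhs_infty_ger.
have n0 : (0 : R) <= n%:R by [].
have dx xi1 : n%:R - A <= mdist p (rho xi1 n%:R).
  have := metric_triangle o p (rho xi1 n%:R).
  by rewrite -{1}(rho0 xi1) mdist_ray// (metric_sym o) -/A; lra.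
have near_ray xi1 : exists2 g, bclass xi1 g /\ g 0 = p &
    forall s : R -> Y, geodesic p (rho xi1 n%:R) s ->
    mdist (s r) (g r) < (e - d) / 3.
  have [g [g0 ag hg]] := ray_from (rho xi1) p YH.
  exists g; first by split=> //; exact: asymptotic_bclass ag.
  move=> s gs; rewrite rho0 -/A in hg.
  apply: le_lt_trans (hg n%:R r s gs _ _ _) _ => //; try lra.
  by apply: le_lt_trans (hN _ nN); rewrite ler_wpM2l// ler_expR; lra.
have [g [xig g0] hg] := near_ray xi; have [g' [xig' g'0] hg'] := near_ray xi'.
have [s gs] := YH.1.1 p x; have [s' gs'] := YH.1.1 p y.
exists g'; split => //.
have c'g : c' r = g r.
  apply: (asymptotic_eq YH.1 (bclass_asymptotic xic' xig)) => //.
  by rewrite c'0 g0.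
have sg := hg _ gs; have sg' := hg' _ gs'.
have ss' : mdist (s r) (s' r) < (e - d) / 3.
  have xA := dx xi; have yA := dx xi'; rewrite -/x -/y in xA yA.
  have h : mdist (s r) (s' r) <=
      6 * expR (r + (mdist x y - mdist p x - mdist p y) / 2).
    by apply: (CATm1_thin YH.1 gs gs'); lra.
  apply: le_lt_trans h _; apply: le_lt_trans (hN _ nN).
  by rewrite ler_wpM2l// ler_expR; lra.
have := metric_triangle (g' r) (s' r) (c r).
have := metric_triangle (s' r) (s r) (c r).
have := metric_triangle (s r) (g r) (c r).
rewrite (metric_sym (g' r) (s' r)) (metric_sym (s' r) (s r)) -c'g -/d.
by rewrite -c'g in sg; lra.
Unshelve. all: by end_near. Qed.

(** Basic open sets are finite intersections of subbasic ones, and finitely many eventual inclusions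
    hold simultaneously. *)
Lemma rho_basis xi (u : set (boundary Y)) : nbhs xi u ->
  \forall n \near \oo, [set xi' | mdist (rho xi n%:R) (rho xi' n%:R) < 1] `<=` u.
Proof.
rewrite nbhsE => -[B [[D' D'sub BE] Bxi] Bu].
move: (Bxi); rewrite -BE => -[V D'V Vxi]; have [F Fsub VE] := D'sub _ D'V.
have Fxi : (\bigcap_(i in [set` F]) i) xi by rewrite VE.
suff : \forall n \near \oo, forall j, [set` F] j ->
    [set xi' | mdist (rho xi n%:R) (rho xi' n%:R) < 1] `<=` j.
  apply: filterS => n h; apply: subset_trans Bu; rewrite -BE => xi' hxi'.
  have VE' : V = \bigcap_(j in [set` F]) j by rewrite -VE.
  have Vxi' : V xi' by rewrite VE' => j Fj; exact: h.
  by exists V.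
apply: (@filter_bigI _ _ F (fun j =>
  [set n : nat | [set xi' | mdist (rho xi n%:R) (rho xi' n%:R) < 1] `<=` j])) => j Fj.
have : j xi by exact: Fxi.
have [c [r [e [r0 _ ->]]]] : cone_subbase j := set_mem (Fsub _ Fj).
exact: cone_nbhs_basis.
Qed.

(** A Lebesgue number lemma: one time [n] serves all of [K]. By [small_step], a time valid at [xi]
    is valid at all nearby points after a delay of 13. *)
Lemma rho_lebesgue (K : set (boundary Y)) (U : set (set (boundary Y))) :
  compact K -> U `<=` open -> K `<=` \bigcup_(u in U) u ->
  exists n : nat, forall xi, K xi -> exists2 u, U u &
    [set xi' | mdist (rho xi n%:R) (rho xi' n%:R) < 1] `<=` u.
Proof.
move=> /compact_near_coveringP cK Uo KU.
suff : \forall n \near \oo, K `<=` [set xi | exists2 u, U u &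
    [set xi' | mdist (rho xi n%:R) (rho xi' n%:R) < 1] `<=` u].
  by move=> [n _ hn]; exists n => xi Kxi; apply: (hn n) => //=.
apply: cK => xi /KU[u Uu uxi].
have [N _ hN] := rho_basis (open_nbhs_nbhs (conj (Uo _ Uu) uxi)).
have N0 : (0 : R) <= N%:R by [].
near=> xi' n => /=; exists u => // xi'' /= h.
apply: (hN N) => //=.
have nN : (N%:R + 13 : R) <= n%:R by near: n; exact: nbhs_infty_ger.
have h1 := small_step N0 nN h.
have h2 : mdist (rho xi' N%:R) (rho xi N%:R) < 1 / 2.
  by near: xi'; apply: rho_nbhs; lra.
have := metric_triangle (rho xi N%:R) (rho xi' N%:R) (rho xi'' N%:R).
by rewrite (metric_sym (rho xi _) (rho xi' _)); lra.
Unshelve. all: by end_near. Qed.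

End boundary.

(** * Chains of sets of small diameter *)

Section chains.
Context {R : realType} {S : Type}.
Variables (d : S -> S -> R) (K : set S) (N : nat) (A : 'I_N -> set S) (eta : R).
Hypothesis d_triangle : forall x y z, d x z <= d x y + d y z.
Hypothesis A_diam : forall i x y, K x -> K y -> A i x -> A i y -> d x y <= eta.

Let meets : rel 'I_N := [rel i j | `[< K `&` (A i `&` A j) !=set0 >]].

(** The connected classes of the graph [meets] are named by their roots; an index that is not a root
    gets the empty set, so no class occurs twice. *)
Definition chain_component (i : 'I_N) : set S :=
  \bigcup_(j in [set j | fingraph.root meets j = i]) A j.

Let meets_sym : connect_sym meets.
Proof. by apply: sym_connect_sym => i j; rewrite /meets /= [A i `&` _]setIC. Qed.

Let path_diam p i x y : path meets i p -> K x -> K y -> A i x -> A (last i p) y ->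
  d x y <= (size p).+1%:R * eta.
Proof.
elim: p i x => [|j p IH] i x /=; first by rewrite mul1r => _; exact: A_diam.
move=> /andP[/asboolP[z [Kz [Aiz Ajz]]] jp] Kx Ky Ax Ay.
apply: le_trans (d_triangle x z y) _.
by rewrite -[(size p).+2]add1n natrD mulrDl mul1r lerD ?(A_diam _ _ Ax)// (IH j).
Qed.

(** Two members are linked by a chain without repetition, hence of at most [N] sets, each
    contributing at most [eta]. *)
Lemma chain_component_diam i x y : 0 <= eta -> K x -> K y ->
  chain_component i x -> chain_component i y -> d x y <= N%:R * eta.
Proof.
move=> eta0 Kx Ky [j jr Ax] [k kr Ay].
have : connect meets j k by rewrite -(root_connect meets_sym) jr kr.
move=> /connectP[p jp kE]; move: Ay; rewrite kE.
case/shortenP: jp => p' jp' up' _ Ay.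
apply: le_trans (path_diam jp' Kx Ky Ax Ay) _.
rewrite ler_wpM2r// ler_nat -[leqRHS]card_ord -/(size (j :: p')).
by rewrite -(card_uniqP up') max_card.
Qed.

Lemma chain_component_disjoint i j x : K x ->
  chain_component i x -> chain_component j x -> i = j.
Proof.
move=> Kx [k /= <- Ax] [l /= <- Ax']; apply/eqP.
rewrite (root_connect meets_sym) connect1//=.
by apply/asboolP; exists x.
Qed.

Lemma sub_chain_component : \bigcup_i A i `<=` \bigcup_i chain_component i.
Proof. by move=> x [i _ Ax]; exists (fingraph.root meets i) => //; exists i. Qed.

End chains.

(** * Lifting closed refinements through a map whose fibres split *)

Section fibers.
Variables (S T : topologicalType) (phi : S -> T) (K : set S) (P : set S -> Prop).
Variable m : nat.
Hypotheses (T_hausdorff : hausdorff_space T) (phi_cont : continuous phi).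
Hypothesis K_compact : compact K.

(** The pieces covering one fibre also cover the nearby fibres. A refinement of these neighbourhoods
    in [T] is pulled back and cut along the pieces; over each of its members a point lies in only
    one cut, so the multiplicity does not grow. *)
Lemma fiber_refinement : has_closed_refinements (phi @` K) m ->
  (forall t, exists (n : nat) (W : 'I_n -> set S),
    [/\ forall i, open (W i), forall i, P (W i),
        forall i j x, K x -> W i x -> W j x -> i = j
      & K `&` phi @^-1` [set t] `<=` \bigcup_i W i]) ->
  exists (k : nat) (F : 'I_k -> set S),
    [/\ closed_fam_of K setT F, \bigcup_i F i = K,
        forall i, exists2 W, P W & F i `<=` W & multiplicity_le F m].
Proof.
move=> Hm HW.
have [n [W HW']] : {n : T -> nat & {W : forall t, 'I_(n t) -> set S & forall t,
    [/\ forall i, open (W t i), forall i, P (W t i),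
      forall i j x, K x -> W t i x -> W t j x -> i = j
      & K `&` phi @^-1` [set t] `<=` \bigcup_i W t i]}}.
  pose HW1 t := cid (HW t); pose HW2 t := cid (projT2 (HW1 t)).
  exists (fun t => projT1 (HW1 t)), (fun t => projT1 (HW2 t)) => t.
  exact: (projT2 (HW2 t)).
have Wopen t i : open (W t i) by have [] := HW' t.
have WP t i : P (W t i) by have [] := HW' t.
have Wdisj t i j x : K x -> W t i x -> W t j x -> i = j.
  by have [_ _ h _] := HW' t; exact: h.
have Wfib t : K `&` phi @^-1` [set t] `<=` \bigcup_i W t i by have [] := HW' t.
(* The points whose fibre in [K] is covered by the pieces chosen for [t]; an open set, since images
   of compact sets are closed in [T]. *)
pose V t := ~` (phi @` (K `&` ~` (\bigcup_i W t i))).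
have Vopen t : open (V t).
  apply: closed_openC; apply: compact_closed => //.
  apply: continuous_compact; first exact: continuous_subspaceT.
  apply: compact_closedI => //; apply: open_closedC.
  by apply: bigcup_open => i _; exact: Wopen.
have Vt t : V t t.
  move=> [x [Kx nW] xt]; apply: nW; apply: Wfib; split => //.
have [] := Hm (range V).
- by move=> _ [t _ <-]; exact: Vopen.
- by move=> _ [x Kx <-]; exists (V (phi x)) => //; exists (phi x).
move=> k [G [[g gclosed GE] GU GV Gm]].
have /choice[tj htj] : forall j, exists t, G j `<=` V t.
  by move=> j; have [_ [t _ <-] ?] := GV j; exists t.
pose J := {j : 'I_k & 'I_(n (tj j))}.
pose E (e : J) := K `&` (phi @^-1` (g (tag e)) `&` W (tj (tag e)) (tagged e)).
have GE' j x : K x -> g j (phi x) -> G j (phi x).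
  by move=> Kx gx; rewrite GE//; split => //; exists x.
have cover j x : K x -> g j (phi x) -> exists i, W (tj j) i x.
  move=> Kx gx; have /htj Vx := GE' _ _ Kx gx.
  have [[i _ ?]|nW] := pselect ((\bigcup_i W (tj j) i) x); first by exists i.
  by case: Vx; exists x.
exists #|{: J}|, (fun e => E (enum_val e)); split.
(* Over one member the pieces are disjoint in [K] and cover, so each is there the complement of the
   others and relatively closed. *)
- exists (fun e => phi @^-1` (g (tag (enum_val e))) `&`
    \bigcap_(i in [set i | i != tagged (enum_val e)]) ~` W _ i).
    move=> e _; apply: closedI.
      by apply: preimage_closed; [move=> x _; exact: phi_cont|exact: gclosed].
    by apply: closed_bigI => i _; exact: open_closedC.
  move=> e _; rewrite /E; case: (enum_val e) => j i /=; apply/seteqP; split => x /=.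
    move=> [Kx [gx Wx]]; split => //; split => // i' /= /eqP i'i Wx'; apply: i'i.
    exact: Wdisj Wx' Wx.
  move=> [Kx [gx nW]]; split => //; split => //.
  have [i' Wi'] := cover _ _ Kx gx.
  have [<-//|/nW//] := eqVneq i' i.
- apply/seteqP; split => x; first by move=> [e _ []].
  move=> Kx; have : (phi @` K) (phi x) by exists x.
  rewrite -GU => -[j _]; rewrite GE// => -[_ gx].
  have [i Wx] := cover _ _ Kx gx.
  exists (enum_rank (Tagged (fun j => 'I_(n (tj j))) i)) => //.
  by rewrite enum_rankK.
- by move=> e; exists (W _ (tagged (enum_val e))) => // x [_ []].
- move=> x; apply: leq_trans (Gm (phi x)).
  (* Disjointness of the pieces makes [f] injective on the cuts containing [x]. *)
  pose f (e : 'I_#|{: J}|) : 'I_k := tag (enum_val e).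
  rewrite -(@card_in_imset _ _ f); last first.
    move=> e e'; rewrite !inE => /asboolP Ex /asboolP Ex' ff.
    apply: enum_val_inj; move: Ex Ex' ff; rewrite /f /E.
    case: (enum_val e) => j i; case: (enum_val e') => j' i' /=.
    move=> [Kx [_ Wx]] [_ [_ Wx']] jj.
    by move: i Wx; rewrite jj => i Wx; rewrite (Wdisj _ _ _ _ Kx Wx Wx').
  apply: subset_leq_card; apply/fintype.subsetP => j /imsetP[e].
  rewrite !inE => /asboolP Ex ->.
  by apply/asboolP; move: Ex => [Kx [gx _]]; exact: GE'.
Qed.

End fibers.

(** * Quasi-isometric maps: perturbation, composition, inversion *)

Section quasi_isometries.
Context {R : realType}.
Implicit Types X Y Z : metricType R.

Lemma ereal_lt_pinfty_ub (x : \bar R) : (x < +oo)%E ->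
  exists2 C : R, 0 <= C & (x < C%:E)%E.
Proof.
case: x => [r| |]// _; last by exists 0 => //; rewrite ltNyr.
exists (Num.max 0 (r + 1)); first by rewrite le_max lexx.
by rewrite lte_fin lt_max ltrDl ltr01 orbT.
Qed.

Lemma bounded_distance X Y (f f' : Y -> X) :
  (ereal_sup [set (mdist (f' y) (f y))%:E | y in [set: Y]] < +oo)%E ->
  exists2 C : R, 0 <= C & forall y, mdist (f' y) (f y) <= C.
Proof.
move=> /ereal_lt_pinfty_ub[C C0 hC]; exists C => // y; rewrite -lee_fin.
by apply: le_trans (ltW hC); apply: ereal_sup_ubound; exists y.
Qed.

Lemma quasi_isometric_map_near X Y (f f' : Y -> X) (C : R) : 0 <= C ->
  (forall y, mdist (f' y) (f y) <= C) ->
  quasi_isometric_map f -> quasi_isometric_map f'.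
Proof.
move=> C0 hC [a [b [a1 b0 h]]]; exists a, (b + 2 * C); split => //; first lra.
move=> x x'; have /andP[h1 h2] := h x x'; have hx := hC x; have hx' := hC x'.
have := metric_triangle (f x) (f' x) (f x').
have := metric_triangle (f' x) (f' x') (f x').
have := metric_triangle (f' x) (f x) (f' x').
have := metric_triangle (f x) (f x') (f' x').
rewrite (metric_sym (f x) (f' x)) (metric_sym (f x') (f' x')).
by move: hx hx' => *; apply/andP; split; lra.
Qed.

Lemma quasi_isometric_map_comp X Y Z (f : X -> Y) (g : Y -> Z) :
  quasi_isometric_map f -> quasi_isometric_map g -> quasi_isometric_map (g \o f).
Proof.
move=> [a [b [a1 b0 h]]] [a' [b' [a'1 b'0 h']]].
have a0 : 0 < a by lra.
have a'0 : 0 < a' by lra.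
exists (a * a'), (a' * b + b'); split.
- by rewrite -[leLHS]mulr1 ler_pM.
- by rewrite addr_ge0// mulr_ge0// ltW.
move=> x y /=; have /andP[h1 h2] := h x y; have /andP[h3 h4] := h' (f x) (f y).
apply/andP; split.
  apply: le_trans h3; rewrite invfM (mulrC a^-1) -mulrA.
  have : a'^-1 * (a^-1 * mdist x y - b) <= a'^-1 * mdist (f x) (f y).
    by rewrite ler_wpM2l// invr_ge0 ltW.
  have : a'^-1 * b <= a' * b.
    by rewrite ler_wpM2r// (le_trans _ a'1)// invf_le1.
  by rewrite mulrBr; lra.
apply: le_trans h4 _; rewrite addrA lerD2r (mulrC a) -mulrA -mulrDr.
by rewrite ler_wpM2l// ltW.
Qed.

Lemma is_netP X (A : set X) :
  is_net A <-> exists2 C : R, 0 <= C & forall x, exists2 a, A a & mdist x a <= C.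
Proof.
split=> [/ereal_lt_pinfty_ub[C C0 hC]|[C C0 hC]].
  exists C => // x; have : (dist_to A x < C%:E)%E.
    by apply: le_lt_trans hC; apply: ereal_sup_ubound; exists x.
  by move=> /ereal_inf_lt[_ [a Aa <-]]; rewrite lte_fin => /ltW; exists a.
apply: (@le_lt_trans _ _ C%:E); last by rewrite ltry.
apply: ge_ereal_sup => _ [x _ <-]; have [a Aa xa] := hC x.
apply: (@le_trans _ _ (mdist x a)%:E); last by rewrite lee_fin.
by apply: ereal_inf_lbound; exists a.
Qed.

(** The inverse up to bounded error sends [y] to a point whose image lies within [C] of [y]. *)
Lemma quasi_isometric_sym X Y : quasi_isometric X Y -> quasi_isometric Y X.
Proof.
move=> [f [[a [b [a1 b0 h]]] /is_netP[C C0 hC]]].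
have a0 : 0 < a by lra.
have /choice[g hg] : forall y, exists x, mdist y (f x) <= C.
  by move=> y; have [_ [x _ <-] ?] := hC y; exists x.
have upper x x' : mdist x x' <= a * (mdist (f x) (f x') + b).
  by have /andP[h1 _] := h x x'; rewrite -ler_pdivrMl//; lra.
have fg y y' : `|mdist (f (g y)) (f (g y')) - mdist y y'| <= 2 * C.
  have hy := hg y; have hy' := hg y'.
  have := metric_triangle (f (g y)) y (f (g y')).
  have := metric_triangle y y' (f (g y')).
  have := metric_triangle y (f (g y)) y'.
  have := metric_triangle (f (g y)) (f (g y')) y'.
  rewrite (metric_sym (f (g y)) y) (metric_sym (f (g y')) y') => *.
  by rewrite ler_norml; apply/andP; split; lra.
exists g; split; last first.
  apply/is_netP; exists (a * (C + b)); first by rewrite mulr_ge0 ?addr_ge0// ltW.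
  move=> x; exists (g (f x)); first by exists (f x).
  apply: le_trans (upper _ _) _; rewrite ler_pM2l// lerD2r.
  exact: hg.
exists a, (a * (2 * C + b)); split => //.
  by rewrite mulr_ge0 ?addr_ge0 ?mulr_ge0// ltW.
move=> y y'; have := fg y y'; rewrite ler_norml => /andP[h1 h2].
apply/andP; split.
  have /andP[_ h3] := h (g y) (g y').
  have : a^-1 * (mdist y y' - (2 * C + b)) <= mdist (g y) (g y').
    by rewrite ler_pdivrMl//; lra.
  have : a^-1 * (2 * C + b) <= a * (2 * C + b).
    by rewrite ler_wpM2r ?addr_ge0 ?mulr_ge0// (le_trans _ a1)// invf_le1.
  by rewrite mulrBr; lra.
apply: le_trans (upper _ _) _; rewrite -mulrDr ler_pM2l//; lra.
Qed.

End quasi_isometries.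

(** * Separated nets and the size function *)

Section nets.
Context {R : realType} {X : metricType R}.

Lemma open_mdist_lt (x : X) (r : R) : open [set y | mdist x y < r].
Proof.
rewrite openE => y /= xy; apply/nbhs_ballP.
exists (r - mdist x y) => /=; first by rewrite subr_gt0.
rewrite ballEmdist => z /= yz.
by apply: le_lt_trans (metric_triangle x y z) _; rewrite -ltrBrDl.
Qed.

Lemma maximal_separated_net_exists (delta : R) :
  exists A : set X, maximal_separated_net delta A.
Proof.
have [] := @Zorn_bigcup X (delta_separated delta).
  move=> F FP Ft a a' [A FA Aa] [A' FA' Aa'].
  have [AA'|A'A] := Ft _ _ FA FA'; first by apply: (FP _ FA') => //; exact: AA'.
  by apply: (FP _ FA) => //; exact: A'A.
move=> A [sA maxA]; exists A; split => // B sB AB.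
apply: contrapT => BA; apply: (maxA B) => //; split => // BA'; apply: BA.
exact/seteqP.
Qed.

Lemma maximal_separated_net_close (delta : R) (A : set X) (x : X) : 0 < delta ->
  maximal_separated_net delta A -> exists2 a, A a & mdist a x < delta.
Proof.
move=> delta0 [sA maxA]; apply: contrapT => h.
have far a : A a -> delta <= mdist a x.
  by move=> Aa; rewrite leNgt; apply/negP => ax; apply: h; exists a.
have xA : A x.
  rewrite -(maxA (A `|` [set x])); [by right| |by move=> a; left].
  move=> a a' [Aa|->] [Aa'|->] aa' //; first exact: sA.
    exact: far.
  by rewrite metric_sym; exact: far.
by have := far _ xA; rewrite mdistxx leNgt delta0.
Qed.

(** An infinite [A] would make the left-hand side [+oo]; a finite one can be enumerated. *)
Lemma counting_enum (A : set X) (r e : R) : 0 < r ->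
  (r^-1%:E * lne (counting A) < e%:E)%E ->
  exists (n : nat) (x : 'I_n -> X), n%:R <= expR (e * r) /\ A `<=` range x.
Proof.
move=> r0; rewrite /counting; case: asboolP => [finA|_] /=; last first.
  by rewrite gt0_muley ?lte_fin ?invr_gt0.
set s := fset_set A => h; exists #|` s|, (fun i => tnth (in_tuple (enum_fset s)) i).
split; last first.
  move=> a Aa; have /tnthP[i ->] : a \in in_tuple (enum_fset s).
    by rewrite /= /s (in_fset_set finA); exact/mem_set.
  by exists i.
(* An empty [A] has logarithm [-oo] and is settled by [0 <= expR _]. *)
move: h; case: #|` s| => [|n]; first by rewrite expR_ge0.
rewrite leNgt ltr0Sn /= -EFinM lte_fin => h.
rewrite -[leLHS]lnK ?posrE// ler_expR; apply: ltW.
by rewrite mulrC -ltr_pdivrMl.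
Qed.

End nets.

(** * Dimension bounds and multiplicities *)

Section dimension.
Context {R : realType} {T : topologicalType}.
Implicit Type K : set T.

Lemma has_closed_refinements_le K (m m' : nat) : (m <= m')%N ->
  has_closed_refinements K m -> has_closed_refinements K m'.
Proof.
move=> mm' h U Uo KU; have [k [F [F1 F2 F3 F4]]] := h U Uo KU.
by exists k, F; split => // x; apply: leq_trans (F4 x) mm'.
Qed.

(** The infimum runs over the values [m' - 1] with [m'] natural, and [m' - 1 < m] means
    [m' <= m]. *)
Lemma compact_dim_lt K (m : nat) : (compact_dim R K < m%:R%:E)%E ->
  has_closed_refinements K m.
Proof.
move=> /ereal_inf_lt[_ [m' hm' <-]]; rewrite lte_fin => m'm.
apply: has_closed_refinements_le hm'.
by rewrite -ltnS -(ltr_nat R) -natr1; lra.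
Qed.

Lemma compact_dim_geN1 K : ((-1)%:E <= compact_dim R K)%E.
Proof.
apply: le_ereal_inf_tmp => _ [m _ <-]; rewrite lee_fin.
by have : 0 <= m%:R :> R by []; lra.
Qed.

Lemma compact_dim_le K (m : nat) : has_closed_refinements K m ->
  (compact_dim R K <= (m%:R - 1)%:E)%E.
Proof. by move=> hm; apply: ereal_inf_lbound; exists m. Qed.

End dimension.

(** * From a subexponential partition to the boundary *)

Section partitions.
Context {R : realType} {X Y : metricType R} {T : topologicalType}.
Variables (f : Y -> X) (g : X -> T) (m : nat).
Hypotheses (YH : CATm1_Hadamard Y) (f_cont : continuous f).
Hypothesis f_qi : quasi_isometric_map f.
Hypotheses (T_hausdorff : hausdorff_space T) (g_cont : continuous g).
Hypothesis g_subexp : subexponential g.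
Hypothesis g_refinements :
  forall K : set X, compact K -> has_closed_refinements (g @` K) m.

Lemma boundary_closed_refinements (K : set (boundary Y)) : compact K ->
  has_closed_refinements K m.
Proof.
move=> cK U Uo KU.
have [->|/set0P[xi0 Kxi0]] := eqVneq K set0.
  exists 0%N, (fun=> set0); split.
  - exists (fun=> setT); first by move=> _ _; exact: closedT.
    by move=> i _; rewrite set0I.
  - by apply/seteqP; split=> // x [].
  - by case.
  - move=> x; apply: leq_trans (max_card _) _; by rewrite card_ord.
have [u0 Uu0 _] := KU _ Kxi0.
have [c0 _] := bclassP xi0; pose o := c0 0.
have /choice[rho hrho] : forall xi, exists c, bclass xi c /\ c 0 = o.
  by move=> xi; exact: bclass_ray_from.
have rho_class xi : bclass xi (rho xi) by have [] := hrho xi.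
have rho0 xi : rho xi 0 = o by have [] := hrho xi.
have [n hn] := rho_lebesgue YH rho_class rho0 cK Uo KU.
have n0 : (0 : R) <= n%:R by [].
have [a [b [a1 b0 hab]]] := f_qi.
have a0 : 0 < a by lra.
have [delta delta0 /(_ delta)] := g_subexp (f o).
have [N Nmax] := @maximal_separated_net_exists R X delta.
move=> /(_ _ (lexx _) Nmax)[sigma0].
pose sigma := Num.max sigma0 delta.
have dsigma : delta <= sigma by rewrite le_max lexx orbT.
move=> /(_ sigma); rewrite {1}le_max lexx => /(_ isT dsigma).
(* Points at distance [r] from [o] have images within [a * r + b] of [f o], so this rate bounds the
   number of net points by [expR (r / 2 + b / (2 * a))], which the contraction by [expR (- r)]
   outweighs. *)
have eps0 : 0 < (2 * a)^-1 by rewrite invr_gt0; lra.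
move=> /(_ _ eps0)[R0 R01 size_lt].
(* Bounds the distance of two points of [Y] whose images lie within [sigma] of one net point. *)
pose D := a * (2 * sigma + b).
(* Chosen for [M%:R * eta < 1] below: that product is at most [6 * expR (n%:R + D / 2 + b / (2 * a)
   - r / 2)]. *)
have [N1 hN1] := expR_small (n%:R + D / 2 + b / (2 * a)) ltr01.
pose r : R := Num.max (2 * N1) (Num.max n%:R R0).
have rN1 : 2 * N1 <= r by rewrite le_max lexx.
have rn : n%:R <= r by rewrite !le_max lexx orbT.
have rR0 : R0 <= r by rewrite !le_max lexx !orbT.
have r0 : 0 <= r by lra.
have rar : r <= a * r by rewrite ler_peMl.
have arb : R0 <= a * r + b by lra.
have arb0 : 0 < a * r + b by lra.
pose F xi := f (rho xi r).
have F_cont : continuous F.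
  move=> xi; apply: (@continuous_comp _ _ _ (fun xi => rho xi r) f).
    exact: (rho_continuous YH rho_class rho0).
  exact: f_cont.
pose phi := g \o F.
have phi_cont : continuous phi.
  by move=> xi; apply: continuous_comp; [exact: F_cont|exact: g_cont].
have phiKm : has_closed_refinements (phi @` K) m.
  rewrite -image_comp; apply: g_refinements.
  by apply: continuous_compact => //; exact: continuous_subspaceT.
pose P W := exists2 u, U u & K `&` W `<=` u.
suff [k [F' [h1 h2 h3 h4]]] : exists (k : nat) (F : 'I_k -> set (boundary Y)),
    [/\ closed_fam_of K setT F, \bigcup_i F i = K,
        forall i, exists2 W, P W & F i `<=` W & multiplicity_le F m].
  exists k, F'; split => // i; have [W [u Uu KWu] FW] := h3 i.
  exists u => // xi Fxi; apply: KWu; split; last exact: FW.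
  by rewrite -h2; exists i.
apply: (fiber_refinement T_hausdorff phi_cont cK phiKm) => t.
have [M [x [Mle xcover]]] := counting_enum arb0 (size_lt _ arb t).
pose A i := [set xi | mdist (x i) (F xi) < sigma].
pose eta := 6 * expR (n%:R + D / 2 - r).
have eta0 : 0 <= eta by rewrite mulr_ge0// expR_ge0.
pose d xi xi' := mdist (rho xi n%:R) (rho xi' n%:R).
have d_triangle xi xi' xi'' : d xi xi'' <= d xi xi' + d xi' xi''.
  exact: metric_triangle.
have A_diam i xi xi' : K xi -> K xi' -> A i xi -> A i xi' -> d xi xi' <= eta.
  move=> _ _ Axi Axi'.
  have dr : mdist (rho xi r) (rho xi' r) <= D.
    have /andP[h _] := hab (rho xi r) (rho xi' r).
    have := metric_triangle (F xi) (x i) (F xi').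
    rewrite (metric_sym (F xi) (x i)) => h'.
    rewrite -ler_pdivrMl//; move: Axi Axi' h h'; rewrite /A /F /=; lra.
  have r1 : 1 <= r by lra.
  have nr : (0 : R) <= n%:R <= r by apply/andP.
  apply: le_trans (rho_thin YH rho0 xi xi' r1 nr) _.
  by rewrite ler_wpM2l// ler_expR; lra.
have Meta : M%:R * eta < 1.
  apply: (@le_lt_trans _ _ (6 * expR (n%:R + D / 2 + b / (2 * a) - r / 2))); last first.
    by apply: hN1; lra.
  rewrite /eta mulrCA ler_wpM2l//.
  apply: le_trans (ler_wpM2r (expR_ge0 _) Mle) _.
  rewrite -expRD ler_expR.
  have -> : (2 * a)^-1 * (a * r + b) = r / 2 + b / (2 * a) by field; lra.
  by lra.
exists M, (chain_component K A); split.
- move=> i; apply: bigcup_open => j _.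
  have /continuousP F_open := F_cont.
  exact: (F_open _ (open_mdist_lt (x j) sigma)).
(* A component that misses [K] satisfies [P] with the default [u0]. *)
- move=> i; have [e|] := eqVneq (K `&` chain_component K A i) set0.
    by exists u0 => //; rewrite e.
  move=> /set0P[xi1 [Kxi1 Wxi1]].
  have [u Uu hu] := hn _ Kxi1; exists u => // xi [Kxi Wxi]; apply: hu => /=.
  apply: le_lt_trans Meta.
  exact: (chain_component_diam d_triangle A_diam eta0 Kxi1 Kxi Wxi1 Wxi).
- by move=> i j xi Kxi Wi Wj; exact: (chain_component_disjoint Kxi Wi Wj).
- move=> xi [Kxi /= phixi]; apply: sub_chain_component.
  (* The net point [z] is counted by the size, because its ball contains [F xi]. *)
  have [z Nz zF] := maximal_separated_net_close (F xi) delta0 Nmax.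
  have [|i _ xz] := xcover z.
    split => //; exists (F xi); split.
      by rewrite ballEmdist /=; apply: lt_le_trans dsigma.
    split; first by [].
    rewrite /cball /= /F -(rho0 xi).
    have /andP[_ h] := hab (rho xi 0) (rho xi r).
    by apply: le_trans h _; rewrite mdist_ray.
  by exists i => //; rewrite /A /= xz; apply: lt_le_trans dsigma.
Qed.

End partitions.

(** * The rank inequalities *)

Section rank.
Context {R : realType}.
Implicit Types X Y : metricType R.

(** By [QPC], [f] may be replaced by a continuous quasi-isometric map at bounded distance, to which
    [boundary_closed_refinements] applies. *)
Lemma QPC_boundary_dim X Y (f : Y -> X) (k : \bar R) : QPC X ->
  CATm1_Hadamard Y -> quasi_isometric_map f ->
  supports_subexp_partition X k -> (top_dim R (boundary Y) <= k)%E.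
Proof.
move=> Xq YH f_qi [T [g [T_h g_cont g_sub kE]]].
have [f' [f'_cont /bounded_distance[C C0 hC]]] := Xq _ _ f_qi.
have f'_qi := quasi_isometric_map_near C0 hC f_qi.
have dim_le (K : set X) : compact K -> (compact_dim R (g @` K) <= k)%E.
  by move=> cK; rewrite -kE; apply: ereal_sup_ubound; exists K.
apply: ge_ereal_sup => _ [K cK <-].
(* The image of the empty compact set enters the rank, which excludes [k = -oo]. *)
have kN1 : ((-1)%:E <= k)%E.
  by apply: le_trans (dim_le _ (@compact0 X)); exact: compact_dim_geN1.
case: k kN1 dim_le {kE} => [k| |] kN1 dim_le; [|by rewrite leey|by []].
rewrite lee_fin in kN1.
(* For the least natural number [m] above [k], the images have refinements of multiplicity [m], and
   [m - 1 <= k] by minimality, or by [kN1] if [m = 0]. *)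
have [|m km mmin] := @ex_minnP (fun m => k < m%:R).
  by eexists; exact: truncnS_gt.
have gm (K' : set X) : compact K' -> has_closed_refinements (g @` K') m.
  move=> cK'; apply: (@compact_dim_lt R).
  by apply: le_lt_trans (dim_le _ cK') _; rewrite lte_fin.
have Km := boundary_closed_refinements YH f'_cont f'_qi T_h g_cont g_sub gm cK.
apply: le_trans (@compact_dim_le R _ _ _ Km) _.
rewrite lee_fin; case: m {km gm Km} mmin => [|m] mmin; first by rewrite sub0r.
rewrite -natr1 addrK leNgt; apply/negP => km.
by have := mmin _ km; rewrite ltnn.
Qed.

Lemma QPC_rank_h_le X (k : \bar R) : QPC X -> supports_subexp_partition X k ->
  (rank_h X <= k)%E.
Proof.
move=> Xq Xk; apply: ge_ereal_sup => _ [Y [_ YH [f f_qi] ->]].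
exact: (QPC_boundary_dim Xq YH f_qi Xk).
Qed.

(** [X'] is itself one of the spaces in the supremum defining [corank X], and a map [Y -> X]
    composes to a map [Y -> X']. *)
Lemma rank_h_le_corank X X' : QPC X' -> quasi_isometric X X' ->
  (rank_h X <= corank X)%E.
Proof.
move=> X'q XX'; have [h [h_qi _]] := XX'.
apply: ge_ereal_sup => _ [Y [_ YH [f f_qi] ->]].
apply: (@le_trans _ _ (ereal_inf [set k | supports_subexp_partition X' k])).
  apply: le_ereal_inf_tmp => k Xk.
  exact: (QPC_boundary_dim X'q YH (quasi_isometric_map_comp f_qi h_qi) Xk).
by apply: ereal_sup_ubound; exists X' => //; exact: quasi_isometric_sym.
Qed.

End rank.

Local Open Scope ereal_scope.


Theorem theorem1p1 (R : realType) (X : metricType R)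
    (hX : exists2 X' : metricType R, QPC X' & quasi_isometric X X') :
  [/\ rank_h X <= corank X,
      (forall Y : metricType R,
         locally_compact [set: Y] -> CATm1_Hadamard Y ->
         corank X < top_dim R (boundary Y) ->
         ~ exists f : Y -> X, quasi_isometric_map f)
    & QPC X ->
      forall k : \bar R, k < rank_h X -> ~ supports_subexp_partition X k].
Proof.
have rank_le : rank_h X <= corank X.
  by have [X' X'q XX'] := hX; exact: rank_h_le_corank X'q XX'.
split => // [Y Ylc YH dim_gt [f f_qi]|Xq k kX Xk].
  have : top_dim R (boundary Y) <= corank X.
    apply: le_trans rank_le; apply: ereal_sup_ubound; exists Y; split => //.
    by exists f.
  by rewrite leNgt dim_gt.
by have := QPC_rank_h_le Xq Xk; rewrite leNgt kX.
Qed.
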